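(* Let $\mathcal H$ be a real Hilbert space, $f:\mathcal H\to\mathbb R$ convex and twice continuously differentiable, with $L$-Lipschitz continuous Hessian for some $L>0$. Assume that $f$ has a unique minimizer $x^*$ and that $\nabla^2f(x^* )$ is non-singular. Let $x_0\in\mathcal H$ and $0<\sigma_\ell<\sigma_u<1$. Then the (infinite) sequence $\{x_k\}$ generated by Algorithm 2 (defined in the context) converges quadratically to $x^*$.
   Context: The Hessian is $L$-Lipschitz continuous: $\|\nabla^2f(x)-\nabla^2f(y)\|\le L\|x-y\|$ for all $x,y\in\mathcal H$, with the operator norm on the left. Non-singular means invertible with bounded inverse. Quadratic convergence of $\{x_k\}$ to $x^*$ means that $x_k\to x^*$ in norm and there exist $C>0$ and $k_0$ such that $\|x_k-x^*\|\le C\|x_{k-1}-x^*\|^2$ for all $k>k_0$. Algorithm 2 (proximal-Newton method): given $x_0\in\mathcal H$ and $0<\sigma_\ell<\sigma_u<1$, at each iteration $k=1,2,\dots$: if $\nabla f(x_{k-1})=0$, stop; otherwise compute $\lambda_k>0$ such that $$\frac{2\sigma_\ell}{L}\le\lambda_k\|(I+\lambda_k\nabla^2f(x_{k-1}))^{-1}\lambda_k\nabla f(x_{k-1})\|\le\frac{2\sigma_u}{L},$$ and set $x_k=x_{k-1}-(I+\lambda_k\nabla^2f(x_{k-1}))^{-1}\lambda_k\nabla f(x_{k-1})$. The sequence being infinite means that $\nabla f(x_k)\ne0$ for all $k\ge0$. *)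

(* Defs.v *)
From HB Require Import structures.
From mathcomp Require Import all_boot all_order all_algebra sesquilinear.
From mathcomp Require Import all_classical all_reals all_analysis.

Set Implicit Arguments.
Unset Strict Implicit.
Unset Printing Implicit Defensive.

Import Order.TTheory GRing.Theory Num.Theory.
Import numFieldNormedType.Exports.

Local Open Scope classical_set_scope.
Local Open Scope ring_scope.

(* Operator norm. The supremum is taken in R, hence it is only meaningful for
   bounded T; it is applied below only to differences of differentials, which
   are bounded at points of differentiability. *)
Definition opnorm (R : realType) (H : normedModType R) (T : H -> H) : R :=
  sup [set `|T v| | v in [set v : H | `|v| <= 1]].

(* The inverse of T when T is bijective. In general: some preimage on the range
   of T, and 0 off the range. *)
Definition opinv (R : realType) (H : normedModType R) (T : H -> H) : H -> H :=
  'pinv_(fun=> 0) [set: H] T.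

Definition nonsingular (R : realType) (H : normedModType R) (T : H -> H) : Prop :=
  bijective T /\ exists M : R, forall v : H, `|opinv T v| <= M * `|v|.

(* The Riesz representative of the Frechet differential; it exists and is unique when
   f is differentiable at x and H is complete for the norm induced by ip. *)
Definition grad (R : realType) (H : normedModType R) (ip : {dot H for idfun})
    (f : H -> R^o) (x : H) : H :=
  xget 0 [set g : H | forall h : H, 'd f x h = ip g h].

Definition hess (R : realType) (H : normedModType R) (ip : {dot H for idfun})
    (f : H -> R^o) (x : H) : {linear H -> H} :=
  'd (grad ip f) x.

Definition twice_continuously_differentiable (R : realType)
    (H : normedModType R) (ip : {dot H for idfun}) (f : H -> R^o) : Prop :=
  [/\ forall x : H, differentiable f x,
      forall x : H, differentiable (grad ip f) x &
      forall x : H,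
        opnorm (hess ip f y \- hess ip f x) @[y --> x] --> (0 : R)].

Definition lipschitz_hessian (R : realType) (H : normedModType R)
    (ip : {dot H for idfun}) (f : H -> R^o) (L : R) : Prop :=
  forall x y : H, opnorm (hess ip f x \- hess ip f y) <= L * `|x - y|.

Definition unique_minimizer (R : realType) (H : normedModType R)
    (f : H -> R^o) (xs : H) : Prop :=
  (forall y : H, f xs <= f y) /\
  (forall z : H, (forall y : H, f z <= f y) -> z = xs).

(* (I + lam * hess f x)^-1 (lam * grad f x) *)
Definition newton_step (R : realType) (H : normedModType R)
    (ip : {dot H for idfun}) (f : H -> R^o) (lam : R) (x : H) : H :=
  opinv (fun v : H => v + lam *: hess ip f x v) (lam *: grad ip f x).

(* The stopping test leaves x and lam unconstrained after the first iterate
   with zero gradient. *)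
Definition proximal_newton (R : realType) (H : normedModType R)
    (ip : {dot H for idfun}) (f : H -> R^o) (L sl su : R) (x0 : H)
    (x : nat -> H) (lam : nat -> R) : Prop :=
  x 0%N = x0 /\
  forall k : nat, (0 < k)%N -> grad ip f (x k.-1) <> 0 ->
    [/\ 0 < lam k,
        2 * sl / L <= lam k * `|newton_step ip f (lam k) (x k.-1)|,
        lam k * `|newton_step ip f (lam k) (x k.-1)| <= 2 * su / L &
        x k = x k.-1 - newton_step ip f (lam k) (x k.-1)].

Definition converges_quadratically (R : realType) (H : normedModType R)
    (x : nat -> H) (xs : H) : Prop :=
  x @ \oo --> xs /\
  exists (C : R) (k0 : nat), 0 < C /\
    forall k : nat, (k0 < k)%N -> `|x k - xs| <= C * `|x k.-1 - xs| ^+ 2.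

(* Main.v *)
Require Import Defs.
From mathcomp Require Import all_boot all_order all_algebra sesquilinear.
From mathcomp Require Import all_classical all_reals all_analysis.
From mathcomp Require Import ring lra.

Set Implicit Arguments.
Unset Strict Implicit.
Unset Printing Implicit Defensive.

Import Order.TTheory GRing.Theory Num.Theory.
Import numFieldNormedType.Exports.

Local Open Scope classical_set_scope.
Local Open Scope ring_scope.

(** Write g and A for the gradient and the Hessian of f, xs for the minimizer,
    and s for the step, so that x' = x - s and s + lam A(x) s = lam g(x). Two
    estimates carry the proof.

    Global convergence. By Taylor's formula with an L-Lipschitz Hessian,
    lam g(x') differs from s by at most lam (L/2) |s|^2 <= su |s|
    ([step_residual]): the step is an implicit gradient step up to a relative
    error su < 1. The gradient inequality at x' then gives the descent
    (1 - su) |s|^2 <= lam (f x - f x') ([step_descent]), and the lower bound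
    c := 2 sl / L <= lam |s| turns it into a decrease of f that is bounded
    below by a power of |g(x')| ([step_descent_lower]). As f is bounded below,
    the gradients tend to 0. Since A(xs) is bounded below, f grows
    quadratically near xs ([quadratic_growth]), and by convexity |g| is bounded
    away from 0 outside every ball around xs ([grad_far]); so the iterates
    converge to xs.

    Quadratic rate. Near xs, A(x) is monotone and |A(x) v| >= (m/2) |v|. Then
    |s + lam A(x) s| >= lam |A(x) s| gives (m/2) |s| <= |g(x)| = O(|x - xs|)
    ([step_hess_le]). On the other side,
    (m/2) |x' - xs| <= |g(x')| <= 2 |s| / lam <= (2/c) |s|^2
    ([grad_lower], [step_grad_le_sqr]). Together, |x' - xs| = O(|x - xs|^2).

    The gradient inequality holds at x only when g(x) represents the
    differential. A non-zero value of [grad] certifies this by itself; it is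
    non-zero at the iterates by assumption, and near xs by Taylor's formula,
    which gives |g(x)| >= (m/2) |x - xs| ([grad_lower], [represented_near]). *)

(** * Inner products compatible with the norm *)

Section InnerProduct.
Context (R : realType) (H : normedModType R) (ip : {dot H for idfun}).
Hypothesis norm_ip : forall v : H, `|v| = Num.sqrt (ip v v).

Lemma ipC u v : ip u v = ip v u.
Proof. by rewrite (hermitian_subproof (s := ip)) expr0 mul1r. Qed.

Lemma ipZl a u v : ip (a *: u) v = a * ip u v.
Proof. exact: linearZl_LR. Qed.

Lemma ipZr a u v : ip u (a *: v) = a * ip u v.
Proof. exact: linearZr_LR. Qed.

Lemma ipvv v : ip v v = `|v| ^+ 2.
Proof.
rewrite norm_ip sqr_sqrtr//; have [->|v0] := eqVneq v 0.
  by rewrite linear0l.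
exact/ltW/neq0_dnorm_gt0.
Qed.

(** Cauchy-Schwarz, by expanding the square of |v| u - |u| v. *)
Lemma ip_le u v : ip u v <= `|u| * `|v|.
Proof.
have [->|u0] := eqVneq u 0; first by rewrite linear0l normr0 mul0r.
have [->|v0] := eqVneq v 0; first by rewrite linear0r normr0 mulr0.
have uv0 : 0 < `|u| * `|v| by rewrite mulr_gt0 ?normr_gt0.
have := ipvv (`|v| *: u - `|u| *: v).
rewrite linearBl !linearBr /= !ipZl !ipZr /= !ipvv (ipC v u) => E.
have E2 : `| `|v| *: u - `|u| *: v| ^+ 2 =
    2 * (`|u| * `|v|) * (`|u| * `|v| - ip u v) by rewrite -E; ring.
have := sqr_ge0 `| `|v| *: u - `|u| *: v|; rewrite E2.
by rewrite pmulr_rge0 ?subr_ge0// mulr_gt0.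
Qed.

Lemma ip_norm_le u v : `|ip u v| <= `|u| * `|v|.
Proof.
by rewrite ler_norml ip_le lerNl -linearNl /= -(normrN u) ip_le.
Qed.

Lemma ip_continuous w : continuous (ip w : H -> R^o).
Proof.
apply: (@bounded_linear_continuous _ _ _ (ip w : {linear H -> R^o})).
apply/linear_boundedP; near=> r => v.
rewrite (le_trans (ip_norm_le w v))// ler_wpM2r//.
Unshelve. all: by end_near. Qed.

(** Taylor's formula with the sharp constant K / 2: against the remainder w, the
    function of t in [0, 1] given by <w, G(x + t d)> minus the quadratic
    <w, dG(x) d> t + (K |d|^2 |w| / 2) t^2 is nonincreasing, and its values at
    0 and 1 give |w|^2 <= (K / 2) |d|^2 |w|. *)
Lemma diff_lipschitz_taylor (G : H -> H) (K : R) (x d : H) :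
    (forall z, differentiable G z) ->
    (forall z v, `|'d G z v - 'd G x v| <= K * `|z - x| * `|v|) ->
  `|G (x + d) - G x - 'd G x d| <= K / 2 * `|d| ^+ 2.
Proof.
move=> dG dGK; set w := _ - 'd G x d.
have [->|w0] := eqVneq w 0.
  have := dGK (x + d) d; rewrite normr0 addrAC subrr add0r.
  by move=> /(le_trans (normr_ge0 _)); lra.
pose a := ip w ('d G x d).
pose c := K * `|d| ^+ 2 * `|w|.
pose h (t : R) : R^o := ip w (G (x + t *: d)).
pose q (t : R) : R^o := a * t + c / 2 * t ^+ 2.
have dh (t : R) : is_derive t 1 h (ip w ('d G (x + t *: d) d)).
  have cv : s^-1 *: ((h \o shift t) (s *: 1) - h t) @[s --> 0^']
            --> (ip w ('d G (x + t *: d) d) : R^o).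
    rewrite -(deriveE d (dG _)).
    have dGt := diff_derivable (v := d) (dG (x + t *: d)).
    have := cvg_comp _ _ dGt (@ip_continuous w _).
    apply: cvg_trans; apply: near_eq_cvg; near=> s => /=.
    rewrite ipZr linearBr /= /h [s%:A]mulr1 scalerDl addrCA.
    by [].
  by apply: DeriveDef; [apply/cvg_ex; eexists; exact: cv
                       |exact: (cvg_lim (@norm_hausdorff _ _) cv)].
have dq (t : R) : is_derive t 1 q (a + c * t).
  have -> : q = a \*: (id : R -> R^o) + (c / 2) \*: (id ^+ 2 : R -> R^o) by [].
  apply: is_derive_eq; rewrite /GRing.scale/=; lra.
have dhq (t : R) : is_derive t 1 (h - q)
    (ip w ('d G (x + t *: d) d) - (a + c * t)).
  exact: is_deriveB.
have : (h - q) 1 <= (h - q) 0.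
  apply: (@ler0_derive1_le_cc _ _ 0 1); rewrite ?bound_itvE//.
  - move=> t t01; rewrite derive1E derive_val; move: t01.
    rewrite in_itv/= => /andP[t0 _].
    rewrite opprD addrA -linearBr/= subr_le0 (le_trans (ip_le _ _))//.
    have := dGK (x + t *: d) d; rewrite addrAC subrr add0r normrZ gtr0_norm//.
    move=> /(ler_wpM2l (normr_ge0 w)) /le_trans; apply.
    rewrite /c; lra.
  - apply: derivable_within_continuous => t _; exact: ex_derive.
have -> : (h - q) 0 = ip w (G x).
  rewrite [LHS](_ : _ = h 0 - q 0)// /h /q scale0r addr0 expr0n/= !mulr0.
  by rewrite addr0 subr0.
have -> : (h - q) 1 = ip w (G (x + d)) - (a + c / 2).
  by rewrite [LHS](_ : _ = h 1 - q 1)// /h /q scale1r expr1n !mulr1.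
rewrite -subr_le0 addrAC -linearBr/= opprD addrA /a -linearBr/= -/w ipvv.
by rewrite subr_le0 expr2 /c mulrAC ler_pM2r ?normr_gt0// mulrAC.
Unshelve. all: by end_near. Qed.

End InnerProduct.

(** * The inverse and the norm of an operator *)

Lemma opinv_notin_range (R : realType) (H : normedModType R) (T : H -> H) v :
  (forall u, T u <> v) -> opinv T v = 0.
Proof.
move=> h; rewrite /opinv/pinv_ splitV.
rewrite (oinv_surj ((fun _ => id) : set_surj [set: H] (T @` [set: H]) T)).
case: pselect => [p|//]; exfalso; by case: p => u _ /h.
Qed.

Lemma le_opnorm (R : realType) (H : normedModType R) (T : {linear H -> H})
    (v : H) :
  continuous T -> `|T v| <= opnorm T * `|v|.
Proof.
move=> cT.
have /linear_boundedP/pinfty_ex_gt0 [M M0 TM] :=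
  (linear_bounded_continuous T).2 cT.
have [->|v0] := eqVneq v 0; first by rewrite linear0 !normr0 mulr0.
have nv0 : 0 < `|v| by rewrite normr_gt0.
rewrite -ler_pdivrMr//; apply: ub_le_sup.
  exists M => _ [u u1 <-]; rewrite (le_trans (TM u))// ler_piMr// ltW//.
exists (`|v|^-1 *: v).
  by rewrite /= normrZ normfV normr_id mulVf ?gt_eqF.
by rewrite linearZ normrZ normfV normr_id mulrC.
Qed.

(** * Differentiable convex functions *)

Lemma convex_segment (R : realType) (H : normedModType R) (f : H -> R^o)
    (x y : H) (t : R) :
    convex_function [set: H] f -> 0 <= t -> t <= 1 ->
  f (x + t *: (y - x)) <= f x + t * (f y - f x).
Proof.
move=> cf t0 t1; have := cf (Itv01 t0 t1) y x (mem_set I) (mem_set I).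
rewrite !convRE/= /unstable.onem.
have -> : conv (Itv01 t0 t1) (y : convex_lmodType H) (x : convex_lmodType H)
          = x + t *: (y - x) :> H.
  rewrite [LHS](_ : _ = t *: y + (1 - t) *: x)//.
  by rewrite scalerBl scale1r scalerBr addrCA.
by move/le_trans; apply; lra.
Qed.

Lemma convex_diff_le (R : realType) (H : normedModType R) (f : H -> R^o)
    (x y : H) :
    convex_function [set: H] f -> differentiable f x ->
  f x + 'd f x (y - x) <= f y.
Proof.
move=> cf df.
have := cvg_dnbhs_at_right (diff_derivable (v := y - x) df).
rewrite [lim _](deriveE _ df) => cv.
rewrite addrC -lerBrDr -(cvg_lim _ cv)//.
apply: limr_le; first by apply/cvg_ex; eexists; exact: cv.
near=> h.
have h0 : 0 < h by near: h; exact: nbhs_right_gt.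
have h1 : h <= 1 by near: h; exact: nbhs_right_le.
rewrite /= [h *: _ + x]addrC /GRing.scale/= mulrC ler_pdivrMr// lerBlDl mulrC.
exact: convex_segment (ltW h0) h1.
Unshelve. all: by end_near. Qed.

Lemma diff_minimizer (R : realType) (H : normedModType R) (f : H -> R^o)
    (x : H) :
  (forall y, f x <= f y) -> differentiable f x -> forall v, 'd f x v = 0.
Proof.
move=> xmin df.
have ge0 v : 0 <= 'd f x v.
  have := cvg_dnbhs_at_right (diff_derivable (v := v) df).
  rewrite [lim _](deriveE _ df) => cv.
  rewrite -(cvg_lim _ cv)//.
  apply: limr_ge; first by apply/cvg_ex; eexists; exact: cv.
  near=> h.
  have h0 : 0 < h by near: h; exact: nbhs_right_gt.
  apply: mulr_ge0; first by rewrite invr_ge0 ltW.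
  by rewrite subr_ge0; exact: xmin.
move=> v; apply/eqP; rewrite eq_le ge0 andbT -oppr_ge0.
by have := ge0 (- v); rewrite linearN.
Unshelve. all: by end_near. Qed.

Lemma nonsingular_bounded_below (R : realType) (H : normedModType R)
    (T : H -> H) :
  nonsingular T -> exists2 m : R, 0 < m & forall v, m * `|v| <= `|T v|.
Proof.
move=> [bijT [M TM]]; exists (`|M| + 1)^-1.
  by rewrite invr_gt0 ltr_wpDl.
move=> v; rewrite mulrC ler_pdivrMr ?ltr_wpDl//.
have := TM (T v); rewrite /opinv pinvKV ?inE//; last first.
  by move=> x y _ _; exact: bij_inj.
move/le_trans; apply; rewrite mulrC ler_wpM2l//.
by rewrite (le_trans (ler_norm M))// lerDl.
Qed.

(** * The gradient and the Hessian *)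

Section ConvexNewton.
Context (R : realType) (H : normedModType R) (ip : {dot H for idfun}).
Hypothesis norm_ip : forall v : H, `|v| = Num.sqrt (ip v v).
Variables (f : H -> R^o) (L : R).
Hypothesis f_convex : convex_function [set: H] f.
Hypothesis f_diff : forall x, differentiable f x.
Hypothesis g_diff : forall x, differentiable (grad ip f) x.
Hypothesis L_gt0 : 0 < L.
Hypothesis f_hess : lipschitz_hessian ip f L.

Local Notation g := (grad ip f).
Local Notation A := (hess ip f).

Lemma hess_lipschitz x y v : `|A x v - A y v| <= L * `|x - y| * `|v|.
Proof.
have cxy : continuous (A x \- A y : {linear H -> H}).
  by move=> u; apply: cvgB; apply: diff_continuous.
apply: (le_trans (le_opnorm v cxy)); rewrite ler_wpM2r//.
exact: f_hess.
Qed.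

Lemma grad_taylor x d : `|g (x + d) - g x - A x d| <= L / 2 * `|d| ^+ 2.
Proof.
apply: diff_lipschitz_taylor => // z v; exact: hess_lipschitz.
Qed.

(** [grad ip f x] takes the default value 0 when the differential has no
    representative; this predicate excludes that case. *)
Definition represented x := forall v, 'd f x v = ip (g x) v.

(** The default value of [grad] is 0, so any other value was found as a
    representative. *)
Lemma represented_neq0 x : g x <> 0 -> represented x.
Proof.
rewrite /represented /grad; case: xgetP => //.
Qed.

Lemma grad_minimizer x : (forall y, f x <= f y) -> represented x /\ g x = 0.
Proof.
move=> xmin; have d0 := diff_minimizer xmin (f_diff x).
have rx : represented x.
  apply: (@xgetPex _ 0 [set u | forall v, 'd f x v = ip u v]).
  by exists 0 => v; rewrite linear0l d0.
split=> //; apply/normr0_eq0/eqP; rewrite -sqrf_eq0 -(ipvv norm_ip).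
by rewrite -rx d0.
Qed.

Lemma grad_ineq x y : represented x -> f x + ip (g x) (y - x) <= f y.
Proof. by move=> <-; exact: convex_diff_le. Qed.

Lemma grad_monotone x y : represented x -> represented y ->
  0 <= ip (g y - g x) (y - x).
Proof.
move=> rx ry; have := grad_ineq y rx; have := grad_ineq x ry.
rewrite -(opprB y x) linearNr linearBl /=; lra.
Qed.

(** * Estimates around a minimizer with non-singular Hessian *)

Section Minimizer.
Variables (xs : H) (m K : R).
Hypothesis xs_min : forall y, f xs <= f y.
Hypothesis m_gt0 : 0 < m.
Hypothesis hess_lower : forall v, m * `|v| <= `|A xs v|.
Hypothesis K_ge : m <= K.
(* The extra term m |v| leaves room for the variation of A on the ball of
   radius 2 r below. *)
Hypothesis hess_upper : forall v, `|A xs v| + m * `|v| <= K * `|v|.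

(* On the ball of radius r the Hessian differs from A xs by at most m / 2. *)
Let r := m / (2 * L).

Let K_gt0 : 0 < K. Proof. exact: lt_le_trans K_ge. Qed.
Let r_gt0 : 0 < r. Proof. by rewrite divr_gt0// mulr_gt0. Qed.
Let Lr : L * r = m / 2. Proof. by rewrite /r; field; rewrite gt_eqF. Qed.

Lemma grad_near x : `|x - xs| <= 2 * r ->
  `|g x - A xs (x - xs)| <= m / 2 * `|x - xs|.
Proof.
move=> xr; have := grad_taylor xs (x - xs); rewrite (subrKC xs x).
have [_ ->] := grad_minimizer xs_min; rewrite subr0 => /le_trans; apply.
rewrite expr2 mulrA ler_wpM2r//.
have := ler_wpM2l (ltW L_gt0) xr; move: Lr; lra.
Qed.

Lemma grad_lower x : `|x - xs| <= 2 * r -> m / 2 * `|x - xs| <= `|g x|.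
Proof.
move=> /grad_near; have := hess_lower (x - xs).
have := ler_distD (g x) (A xs (x - xs)) 0; rewrite !subr0 distrC.
lra.
Qed.

Lemma grad_upper x : `|x - xs| <= 2 * r -> `|g x| <= K * `|x - xs|.
Proof.
move=> /grad_near; have := hess_upper (x - xs).
have := ler_distD (A xs (x - xs)) (g x) 0; rewrite !subr0.
have : 0 <= m * `|x - xs| by rewrite mulr_ge0// ltW.
lra.
Qed.

Lemma represented_near x : `|x - xs| <= 2 * r -> represented x.
Proof.
move=> xr; have [->|xxs] := eqVneq x xs; first by case: (grad_minimizer xs_min).
apply: represented_neq0 => gx0; have := grad_lower xr.
rewrite gx0 normr0 leNgt mulr_gt0 ?normr_gt0 ?subr_eq0// divr_gt0//.
Qed.

Lemma hess_near x v : `|x - xs| <= 2 * r -> `|A x v - A xs v| <= m * `|v|.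
Proof.
move=> xr; apply: (le_trans (hess_lipschitz _ _ _)); rewrite ler_wpM2r//.
have := ler_wpM2l (ltW L_gt0) xr; move: Lr; lra.
Qed.

Lemma hess_upper_near x v : `|x - xs| <= 2 * r -> `|A x v| <= K * `|v|.
Proof.
move=> /(hess_near v); have := hess_upper v.
have := ler_distD (A xs v) (A x v) 0; rewrite !subr0; lra.
Qed.

Lemma hess_lower_near x v : `|x - xs| <= r -> m / 2 * `|v| <= `|A x v|.
Proof.
move=> xr; have : `|A x v - A xs v| <= m / 2 * `|v|.
  apply: (le_trans (hess_lipschitz _ _ _)); rewrite ler_wpM2r//.
  by rewrite -Lr ler_pM2l.
have := hess_lower v.
have := ler_distD (A x v) (A xs v) 0; rewrite !subr0 distrC; lra.
Qed.

(** The differential of a monotone map is monotone: in Taylor's formula along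
    t v, a negative <A(x) v, v> dominates the remainder for small t. Only points
    near the minimizer are compared, so that the gradients involved represent
    the differentials. *)
Lemma hess_psd_near x v : `|x - xs| <= r -> 0 <= ip (A x v) v.
Proof.
move=> xr; rewrite leNgt; apply/negP; set a := ip _ _ => a0.
have v0 : v != 0.
  by apply/eqP => v0; move: a0; rewrite /a v0 linear0r ltxx.
have nv0 : 0 < `|v| by rewrite normr_gt0.
(* The first bound keeps x + t v within 2 r of xs, the second one makes the
   Taylor remainder at most half of t |a|. *)
pose t := Num.min (r / `|v|) (- a / (L * `|v| ^+ 3)).
have t0 : 0 < t.
  by rewrite lt_min !divr_gt0 ?oppr_gt0// mulr_gt0// exprn_gt0.
have tr : t * `|v| <= r by rewrite -ler_pdivlMr// ge_min lexx.
have ta : t * (L * `|v| ^+ 3) <= - a.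
  by rewrite -ler_pdivlMr ?mulr_gt0 ?exprn_gt0// ge_min lexx orbT.
have yr : `|x + t *: v - xs| <= 2 * r.
  have := ler_normD (x - xs) (t *: v).
  by rewrite normrZ (gtr0_norm t0) addrAC; move: xr tr; lra.
have xr2 : `|x - xs| <= 2 * r by move: xr r_gt0; lra.
have := grad_monotone (represented_near xr2) (represented_near yr).
rewrite addrAC subrr add0r ipZr/= pmulr_rge0// => mono.
have := ip_le norm_ip (g (x + t *: v) - g x - A x (t *: v)) v.
have := ler_wpM2r (ltW nv0) (grad_taylor x (t *: v)).
have -> : A x (t *: v) = t *: A x v by rewrite linearZ.
rewrite linearBl/= ipZl/= -/a normrZ (gtr0_norm t0).
have : t * (t * (L * `|v| ^+ 3)) <= t * - a by rewrite ler_pM2l.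
have : t * a < 0 by rewrite pmulr_rlt0.
move: mono; lra.
Qed.

(** A gradient step of length t = 1 / (4 K) to y = x - t g(x) changes the
    gradient by at most |g(x)| / 2, hence decreases f by at least
    t |g(x)|^2 / 2; the value reached is still at least f(xs), and
    |g(x)| >= (m / 2) |x - xs|. *)
Lemma quadratic_growth x : `|x - xs| <= r ->
  m ^+ 2 / (32 * K) * `|x - xs| ^+ 2 <= f x - f xs.
Proof.
move=> xr; have xr2 : `|x - xs| <= 2 * r by move: xr r_gt0; lra.
pose t := (4 * K)^-1.
have t0 : 0 < t by rewrite invr_gt0 mulr_gt0.
have tK : t * K = 4^-1 by rewrite /t; field; rewrite gt_eqF.
pose y := x + - t *: g x.
have tg : t * `|g x| <= `|x - xs| / 4.
  by rewrite mulrC -tK mulrA mulrAC ler_pM2r// mulrC; exact: grad_upper.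
have yr : `|y - xs| <= 2 * r.
  have := ler_normD (x - xs) (- t *: g x).
  rewrite normrZ normrN (gtr0_norm t0) addrAC -/y; move: xr tg r_gt0; lra.
have gyx : `|g y - g x| <= `|g x| / 2.
  have := grad_taylor x (- t *: g x); rewrite -/y.
  have := hess_upper_near (- t *: g x) xr2.
  rewrite normrZ normrN (gtr0_norm t0) => AK.
  have := ler_distD (A x (- t *: g x)) (g y - g x) 0; rewrite !subr0.
  have : L / 2 * (t * `|g x|) ^+ 2 <= K * (t * `|g x|).
    rewrite expr2 [leLHS]mulrA ler_wpM2r ?mulr_ge0 ?(ltW t0)//.
    have := ler_wpM2l (ltW L_gt0) tg; have := ler_wpM2l (ltW L_gt0) xr.
    by rewrite Lr; move: K_ge m_gt0; lra.
  have : K * (t * `|g x|) = `|g x| / 4 by rewrite mulrA (mulrC K) tK mulrC.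
  move: AK; lra.
have := grad_ineq x (represented_near yr).
have -> : x - y = t *: g x by rewrite /y scaleNr opprB addrC subrK.
rewrite ipZr/=.
have := xs_min y.
have := ip_norm_le norm_ip (g y - g x) (g x); rewrite ler_norml => /andP[+ _].
have := ler_wpM2r (normr_ge0 (g x)) gyx.
rewrite linearBl/= (ipvv norm_ip) => E1 E2 E3 E4.
have E5 : t * (`|g x| ^+ 2 / 2) <= t * ip (g y) (g x).
  by rewrite ler_pM2l//; move: E1 E2; lra.
have E6 : (m / 2 * `|x - xs|) ^+ 2 <= `|g x| ^+ 2.
  rewrite lerXn2r ?nnegrE ?mulr_ge0 ?divr_ge0 ?(ltW m_gt0)//.
  exact: grad_lower.
have := ler_wpM2l (ltW t0) E6.
have -> : m ^+ 2 / (32 * K) * `|x - xs| ^+ 2 = t * (m / 2 * `|x - xs|) ^+ 2 / 2.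
  by rewrite /t; field; rewrite gt_eqF.
move: E3 E4 E5; lra.
Qed.

(** Convexity transports the growth of f from the sphere of radius e around xs
    to the points beyond it: f(x) - f(xs) is at least proportional to
    |x - xs|, and it is at most |g(x)| |x - xs|. *)
Lemma grad_far x e : 0 < e -> e <= r -> e <= `|x - xs| -> g x <> 0 ->
  m ^+ 2 / (32 * K) * e <= `|g x|.
Proof.
move=> e0 er ex gx; set b := _ / _.
have n0 : 0 < `|x - xs| by exact: lt_le_trans ex.
pose t := e / `|x - xs|.
have t0 : 0 < t by rewrite divr_gt0.
have t1 : t <= 1 by rewrite ler_pdivrMr// mul1r.
have tn : t * `|x - xs| = e by rewrite divfK// gt_eqF.
have := convex_segment xs x f_convex (ltW t0) t1.
have := @quadratic_growth (xs + t *: (x - xs)).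
rewrite addrAC subrr add0r normrZ (gtr0_norm t0) tn -/b => /(_ er) E1 E2.
have E3 : b * e ^+ 2 <= t * (f x - f xs) by move: E1 E2; lra.
have := grad_ineq xs (represented_neq0 gx).
rewrite -(opprB x xs) linearNr/= => E4.
have E5 : t * (f x - f xs) <= t * (`|g x| * `|x - xs|).
  by rewrite ler_pM2l//; have := ip_le norm_ip (g x) (x - xs); move: E4; lra.
rewrite -(ler_pM2r e0) -mulrA -expr2 (le_trans E3)// (le_trans E5)//.
by rewrite mulrCA tn.
Qed.

End Minimizer.

(** * One proximal-Newton step *)

Section Step.
Variables (x : H) (lam c su : R).
Let s := newton_step ip f lam x.
Hypothesis lam_gt0 : 0 < lam.
Hypothesis c_gt0 : 0 < c.
Hypothesis s_lower : c <= lam * `|s|.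
Hypothesis s_upper : lam * `|s| <= 2 * su / L.
Hypothesis su_lt1 : su < 1.

Let s_gt0 : 0 < `|s|.
Proof. by rewrite -(pmulr_rgt0 _ lam_gt0) (lt_le_trans c_gt0). Qed.

(** [opinv] vanishes off the range of the operator, and the lower bound
    c <= lam |s| forces s <> 0; so lam g(x) lies in the range of
    I + lam A(x). *)
Lemma newton_stepE : s + lam *: A x s = lam *: g x.
Proof.
have [[u Tu]|noT] := pselect (exists u, u + lam *: A x u = lam *: g x).
  have gT : lam *: g x \in range (fun v => v + lam *: A x v).
    by rewrite inE; exists u.
  exact: pinvK gT.
have := s_gt0; rewrite /s /newton_step opinv_notin_range ?normr0 ?ltxx//.
move=> u Tu.
by apply: noT; exists u.
Qed.

(** By the resolvent equation the left-hand side is lam times the Taylor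
    remainder of g at x, and lam |s| <= 2 su / L. *)
Lemma step_residual : `|lam *: g (x - s) - s| <= su * `|s|.
Proof.
have -> : lam *: g (x - s) - s = lam *: (g (x - s) - g x - A x (- s)).
  rewrite !scalerBr -newton_stepE linearN/= scalerN opprK opprD addrA.
  by rewrite subrK.
rewrite normrZ (gtr0_norm lam_gt0).
have := ler_wpM2l (ltW lam_gt0) (grad_taylor x (- s)); rewrite normrN.
move/le_trans; apply.
have -> : lam * (L / 2 * `|s| ^+ 2) = lam * `|s| * (L / 2) * `|s| by ring.
rewrite ler_pM2r//.
have -> : su = 2 * su / L * (L / 2) by field; rewrite gt_eqF.
by rewrite ler_pM2r// divr_gt0.
Qed.

Lemma step_grad_le : lam * `|g (x - s)| <= 2 * `|s|.
Proof.
have := ler_normD (lam *: g (x - s) - s) s.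
rewrite subrK normrZ (gtr0_norm lam_gt0).
have := step_residual; have : su * `|s| <= `|s| by rewrite ler_piMl// ltW.
lra.
Qed.

Lemma step_grad_le_sqr : c * `|g (x - s)| <= 2 * `|s| ^+ 2.
Proof.
have := ler_wpM2r (normr_ge0 s) step_grad_le.
have := ler_wpM2r (normr_ge0 (g (x - s))) s_lower.
rewrite expr2; lra.
Qed.

Lemma step_descent : g (x - s) <> 0 ->
  (1 - su) * `|s| ^+ 2 <= lam * (f x - f (x - s)).
Proof.
move=> gx'; have := grad_ineq x (represented_neq0 gx').
rewrite subKr -lerBrDl => E1.
have := ler_wpM2l (ltW lam_gt0) E1.
have := ip_norm_le norm_ip (lam *: g (x - s) - s) s.
rewrite ler_norml => /andP[+ _]; rewrite linearBl/= ipZl/= (ipvv norm_ip).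
have := ler_wpM2r (normr_ge0 s) step_residual.
rewrite expr2; lra.
Qed.

(** The multiplier lam, for which no bound is known, has to be eliminated: with
    lam e <= 2 |s| the descent becomes (1 - su) e |s| <= 2 (f x - f x'), and
    c e <= 2 |s|^2 bounds |s| from below. Squaring avoids fractional powers. *)
Lemma step_descent_lower e : 0 < e -> e <= `|g (x - s)| ->
  c * (1 - su) ^+ 2 * e ^+ 3 / 8 <= (f x - f (x - s)) ^+ 2.
Proof.
move=> e0 eg; have gx' : g (x - s) <> 0.
  by move=> g0; move: eg; rewrite g0 normr0 leNgt e0.
have su1 : 0 < 1 - su by rewrite subr_gt0.
have E1 : (1 - su) * e * `|s| <= 2 * (f x - f (x - s)).
  have le : lam * e <= 2 * `|s|.
    by apply: (le_trans _ step_grad_le); rewrite ler_pM2l.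
  rewrite -(ler_pM2r (mulr_gt0 lam_gt0 s_gt0)).
  have := ler_wpM2r (normr_ge0 s) (step_descent gx').
  have := ler_wpM2l (mulr_ge0 (ltW su1) (sqr_ge0 `|s|)) le.
  lra.
have E2 : c * e <= 2 * `|s| ^+ 2.
  by apply: (le_trans _ step_grad_le_sqr); rewrite ler_pM2l.
have E0 : 0 <= (1 - su) * e * `|s| by rewrite !mulr_ge0 ?(ltW su1) ?(ltW e0).
have E3 : ((1 - su) * e * `|s|) ^+ 2 <= (2 * (f x - f (x - s))) ^+ 2.
  by rewrite lerXn2r ?nnegrE// (le_trans E0).
have := ler_wpM2l (sqr_ge0 ((1 - su) * e)) E2.
move: E3; lra.
Qed.

(** Monotonicity of A(x) makes the cross term of |s + lam A(x) s|^2
    nonnegative, so this norm is at least lam |A(x) s|. *)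
Lemma step_hess_le : 0 <= ip (A x s) s -> `|A x s| <= `|g x|.
Proof.
move=> psd; rewrite -(ler_pM2l lam_gt0) -[X in X * `|g x|](gtr0_norm lam_gt0).
rewrite -normrZ -newton_stepE.
rewrite -ler_sqr ?nnegrE ?mulr_ge0 ?(ltW lam_gt0)//.
rewrite -[leRHS](ipvv norm_ip) linearDl !linearDr/= !ipZr !ipZl /=.
rewrite (ipC _ s (A x s)) !(ipvv norm_ip) exprMn.
have := mulr_ge0 (ltW lam_gt0) psd; have := sqr_ge0 `|s|.
lra.
Qed.

End Step.

End ConvexNewton.

(** * Convergence *)

Theorem theorem7p6 (R : realType) (H : completeNormedModType R)
    (ip : {dot H for idfun})
    (norm_ip : forall v : H, `|v| = Num.sqrt (ip v v))
    (f : H -> R^o)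
    (f_convex : convex_function [set: H] f)
    (f_C2 : twice_continuously_differentiable ip f)
    (L : R) (L_gt0 : 0 < L)
    (f_hess : lipschitz_hessian ip f L)
    (xs : H) (xs_min : unique_minimizer f xs)
    (hess_xs : nonsingular (hess ip f xs))
    (sl su : R) (sl_gt0 : 0 < sl) (sl_lt_su : sl < su) (su_lt1 : su < 1)
    (x0 : H) (x : nat -> H) (lam : nat -> R)
    (x_alg : proximal_newton ip f L sl su x0 x lam)
    (x_infinite : forall k : nat, grad ip f (x k) <> 0) :
  converges_quadratically x xs.
Proof.
have [f_diff g_diff _] := f_C2; have [f_min _] := xs_min.
have [_ step] := x_alg.
have [m m0 Am] := nonsingular_bounded_below hess_xs.
have [M M0 AM] : exists2 M : R, 0 < M & forall v, `|hess ip f xs v| <= M * `|v|.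
  apply: pinfty_ex_gt0; apply/linear_boundedP.
  by apply/linear_bounded_continuous; exact: diff_continuous.
pose K := M + m.
have Km : m <= K by rewrite lerDr ltW.
have AK v : `|hess ip f xs v| + m * `|v| <= K * `|v| by rewrite mulrDl lerD2r.
have K0 : 0 < K by rewrite addr_gt0.
pose r := m / (2 * L).
have r0 : 0 < r by rewrite divr_gt0// mulr_gt0.
pose c := 2 * sl / L.
have c0 : 0 < c by rewrite !divr_gt0// mulr_gt0.
pose s k := newton_step ip f (lam k.+1) (x k).
have stepS k : [/\ 0 < lam k.+1, c <= lam k.+1 * `|s k|,
    lam k.+1 * `|s k| <= 2 * su / L & x k.+1 = x k - s k].
  by have := step k.+1 isT; apply; exact: x_infinite.
have f_decr k : f (x k.+1) <= f (x k).
  have [l0 sL sU xE] := stepS k.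
  have gx' : grad ip f (x k - s k) <> 0 by rewrite -xE.
  have := step_descent norm_ip f_convex f_diff g_diff L_gt0 f_hess
    l0 c0 sL sU gx'.
  rewrite -xE => E; rewrite -subr_ge0 -(pmulr_rge0 _ l0) (le_trans _ E)//.
  by rewrite mulr_ge0 ?sqr_ge0// subr_ge0 ltW.
have decr_cvg : (f (x k) - f (x k.+1)) ^+ 2 @[k --> \oo] --> (0 : R).
  pose u k : R := f (x k).
  have u_cvg : u @ \oo --> limn u.
    apply: nonincreasing_is_cvgn; first exact/nonincreasing_seqP.
    by exists (f xs) => _ [k _ <-]; exact: f_min.
  have uS_cvg := u_cvg; rewrite -cvg_shiftS in uS_cvg.
  have d_cvg : u k - u k.+1 @[k --> \oo] --> (0 : R).
    by rewrite -(subrr (limn u)); exact: cvgB.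
  by rewrite -(mulr0 (0 : R)); exact: (cvgM d_cvg d_cvg).
have x_cvg : x @ \oo --> xs.
  rewrite -cvg_shiftS; apply/cvgrPdist_lt => e e0.
  (* An iterate at distance at least e from xs would have a gradient of norm at
     least b, hence a decrease of f that is eventually impossible. *)
  pose e' := Num.min e r.
  have e'0 : 0 < e' by rewrite lt_min e0.
  pose b := m ^+ 2 / (32 * K) * e'.
  have b0 : 0 < b by rewrite mulr_gt0// divr_gt0 ?exprn_gt0 ?mulr_gt0.
  have kappa0 : 0 < c * (1 - su) ^+ 2 * b ^+ 3 / 8.
    apply: divr_gt0 => //; apply: mulr_gt0; last exact: exprn_gt0.
    by apply: mulr_gt0 => //; rewrite exprn_gt0 ?subr_gt0.
  apply: filterS (cvgr_lt _ decr_cvg _ kappa0) => k.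
  apply: contraTT; rewrite -!leNgt distrC => ek.
  have [l0 sL sU xE] := stepS k.
  have bg : b <= `|grad ip f (x k.+1)|.
    apply: (grad_far norm_ip f_convex f_diff g_diff L_gt0 f_hess f_min m0
      Am Km AK).
    - exact: e'0.
    - by rewrite ge_min lexx orbT.
    - by rewrite (le_trans _ ek)// ge_min lexx.
    - exact: x_infinite.
  rewrite xE; rewrite xE in bg.
  exact: (step_descent_lower norm_ip f_convex f_diff g_diff L_gt0 f_hess
    l0 c0 sL sU su_lt1 b0 bg).
have x_near : \forall k \near \oo, `|x k - xs| <= r.
  exact: cvgr_distC_le x_cvg _ r0.
split => //.
pose C := 2 / m * (2 / c * (2 * K / m) ^+ 2).
have C0 : 0 < C.
  apply: mulr_gt0; [|apply: mulr_gt0; [|apply: exprn_gt0]];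
    apply: divr_gt0 => //.
  exact: mulr_gt0.
move: x_near => [k0 _ x_near].
exists C, k0; split => // -[//|k] kk0 /=.
have xr : `|x k - xs| <= r by exact: x_near.
have x'r : `|x k.+1 - xs| <= r by apply: x_near; exact: leqW.
have [l0 sL sU xE] := stepS k.
have r2 y : y <= r -> y <= 2 * r by move: r0; lra.
have psd := hess_psd_near norm_ip f_convex f_diff g_diff L_gt0 f_hess
  f_min m0 Am (s k) xr.
have E1 := step_hess_le norm_ip l0 c0 sL psd.
have E2 := hess_lower_near g_diff L_gt0 f_hess Am (s k) xr.
have E3 := grad_upper norm_ip f_diff g_diff L_gt0 f_hess f_min m0 AK
  (r2 _ xr).
have E4 := grad_lower norm_ip f_diff g_diff L_gt0 f_hess f_min Am
  (r2 _ x'r).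
have E5 := step_grad_le_sqr norm_ip g_diff L_gt0 f_hess l0 c0 sL sU su_lt1.
rewrite -/(s k) -xE in E5.
have sE : `|s k| <= 2 * K / m * `|x k - xs|.
  rewrite -(ler_pM2l (divr_gt0 m0 (ltr0n _ 2))).
  have -> : m / 2 * (2 * K / m * `|x k - xs|) = K * `|x k - xs|.
    by field; rewrite gt_eqF.
  by rewrite (le_trans E2)// (le_trans E1).
have s2 : `|s k| ^+ 2 <= (2 * K / m * `|x k - xs|) ^+ 2.
  by rewrite lerXn2r ?nnegrE// (le_trans _ sE).
rewrite -(ler_pM2l (divr_gt0 m0 (ltr0n _ 2))) (le_trans E4)//.
rewrite -(ler_pM2l c0) (le_trans E5)//.
have -> : c * (m / 2 * (C * `|x k - xs| ^+ 2)) =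
    2 * (2 * K / m * `|x k - xs|) ^+ 2.
  by rewrite /C; field; rewrite !gt_eqF.
by rewrite ler_pM2l.
Qed.
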